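(* Let $K\ge 2$, $L\ge 2$, $N_B,N_U,d_s\ge 1$ be integers and consider the multi-cell interfering MIMO multiple-access system $(K,L,N_B,N_U,d_s)$ described in the context. If $$N_U \;\ge\; \frac{L-1}{L}N_B+\frac1L d_s\qquad\text{and}\qquad N_B\;\ge\;\big((K-1)L+1\big)d_s ,$$ then, almost surely with respect to the channel realization, at least $d_s$ degrees of freedom (DoF) per user, and hence at least $KLd_s$ DoF in total, can be achieved by the grouping-based interference alignment (GIA) method; that is, there exist an assignment $\pi$, precoders $\boldsymbol V_{i,k}\in\mathbb C^{N_U\times d_s}$ with $\mathrm{Tr}(\boldsymbol V_{i,k}^H\boldsymbol V_{i,k})\le P_{i,k}$, and decoders $\boldsymbol U_{i,k}\in\mathbb C^{N_B\times d_s}$ ($1\le i\le L$, $1\le k\le K$) satisfying the GIA alignment condition, the interference-nulling conditions and the rank condition listed in the context.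
   Context: System: there are $K$ cells, each with one base station (BS) having $N_B$ antennas and $L$ users having $N_U$ antennas each. User $i$ of cell $k$ is denoted $(i,k)$ and has power budget $P_{i,k}>0$. The channel from user $(i,k)$ to BS $\ell$ is $\boldsymbol H_{i,k}^{\ell}=\sqrt{\eta_{i,k}^{\ell}}\,\overline{\boldsymbol H}_{i,k}^{\ell}\in\mathbb C^{N_B\times N_U}$, where $\eta_{i,k}^\ell>0$ is a deterministic path-loss constant and the matrices $\overline{\boldsymbol H}_{i,k}^{\ell}$ are mutually independent with i.i.d. standard circularly symmetric complex Gaussian entries (Rayleigh fading). Each user $(i,k)$ sends $d_s$ data streams using a linear precoder $\boldsymbol V_{i,k}\in\mathbb C^{N_U\times d_s}$, and BS $k$ decodes them using a linear decoder $\boldsymbol U_{i,k}\in\mathbb C^{N_B\times d_s}$. $d_s$ DoF per user are achieved when the following hold for all $(i,k)$: - (nulling of inter-user interference) $\boldsymbol U_{i,k}^H\boldsymbol H_{j,k}^k\boldsymbol V_{j,k}=\boldsymbol 0$ for all $j\ne i$; - (nulling of inter-cell interference) $\boldsymbol U_{i,k}^H\boldsymbol H_{m,\ell}^k\boldsymbol V_{m,\ell}=\boldsymbol 0$ for all $\ell\neq k$ and all $m$; - (rank condition) $\mathrm{rank}(\boldsymbol U_{i,k}^H\boldsymbol H_{i,k}^k\boldsymbol V_{i,k})=d_s$. GIA method: an assignment is a permutation $\pi$ of $\{1,\dots,K\}$ without fixed points, meaning that cell $k$ aligns its interference at cell $\pi(k)$ (for example $\pi(k)=k+1$ modulo $K$).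 The precoders satisfy the GIA alignment condition if for every $k$ $$\mathrm{Span}\{\boldsymbol H_{1,k}^{\pi(k)}\boldsymbol V_{1,k}\}=\cdots=\mathrm{Span}\{\boldsymbol H_{L,k}^{\pi(k)}\boldsymbol V_{L,k}\},$$ where $\mathrm{Span}\{\boldsymbol X\}$ is the column space of $\boldsymbol X$. *)

(* Defs.v *)
From HB Require Import structures.
From mathcomp Require Import all_boot all_order all_algebra perm.
From mathcomp Require Import all_classical all_reals all_analysis.
From mathcomp Require Import complex.

Set Implicit Arguments.
Unset Strict Implicit.
Unset Printing Implicit Defensive.

Import Order.TTheory GRing.Theory Num.Theory.
Local Open Scope classical_set_scope.
Local Open Scope ring_scope.
Local Open Scope complex_scope.
Local Open Scope sesquilinear_scope.

Section Probability.
Context (R : realType) (d : measure_display) (T : measurableType d).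
Context (P : probability T R).

(* Mutual independence of a finite family of sub-sigma-algebras of T. *)
Definition mutually_independent (I : finType) (F : I -> set (set T)) : Prop :=
  forall (J : {set I}) (E : I -> set T),
    (forall i, i \in J -> F i (E i)) ->
    P (\bigcap_(i in [set` J]) E i) = (\prod_(i in J) P (E i))%E.

(* sigma(Z): C carries the Borel sigma-algebra of R^2 through (Re, Im). *)
Definition sigma_complex (Z : T -> R[i]) : set (set T) :=
  g_sigma_preimageU (fun t => complex.Re (Z t)) (fun t => complex.Im (Z t)).

Definition sigma_matrix (m n : nat) (H : T -> 'M[R[i]]_(m, n)) : set (set T) :=
  <<s \bigcup_(ab in [set: 'I_m * 'I_n])
        sigma_complex (fun t => H t ab.1 ab.2) >>.

Definition has_normal_law (X : T -> R) (m s : R) : Prop :=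
  measurable_fun setT X /\
  forall B : set R, measurable B -> pushforward P X B = normal_prob m s B.

(* CN(0, 1): real and imaginary parts are independent N(0, 1/2); the last
   argument of [has_normal_law] is the standard deviation. *)
Definition std_complex_gaussian (Z : T -> R[i]) : Prop :=
  let X := fun t => complex.Re (Z t) in
  let Y := fun t => complex.Im (Z t) in
  [/\ has_normal_law X 0 (Num.sqrt 2^-1),
      has_normal_law Y 0 (Num.sqrt 2^-1)
    & mutually_independent
        (fun b : bool => g_sigma_algebra_preimage (if b then X else Y))].

(* [Hbar i k l] is the normalized channel from user (i, k) to BS l. *)
Definition rayleigh_fading (K L NB NU : nat)
    (Hbar : 'I_L -> 'I_K -> 'I_K -> T -> 'M[R[i]]_(NB, NU)) : Prop :=
  [/\ mutually_independent (fun u : 'I_L * 'I_K * 'I_K =>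
        sigma_matrix (Hbar u.1.1 u.1.2 u.2)),
      forall i k l, mutually_independent (fun ab : 'I_NB * 'I_NU =>
        sigma_complex (fun t => Hbar i k l t ab.1 ab.2))
    & forall i k l a b, std_complex_gaussian (fun t => Hbar i k l t a b)].

End Probability.

Section Network.
Context (R : realType) (K L NB NU ds : nat).

Definition channel (T : Type) (eta : 'I_L -> 'I_K -> 'I_K -> R)
    (Hbar : 'I_L -> 'I_K -> 'I_K -> T -> 'M[R[i]]_(NB, NU)) (t : T)
    (i : 'I_L) (k l : 'I_K) : 'M[R[i]]_(NB, NU) :=
  (Num.sqrt (eta i k l))%:C *: Hbar i k l t.

Context (H : 'I_L -> 'I_K -> 'I_K -> 'M[R[i]]_(NB, NU)).
Context (V : 'I_L -> 'I_K -> 'M[R[i]]_(NU, ds)).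
Context (U : 'I_L -> 'I_K -> 'M[R[i]]_(NB, ds)).

(* [<=] on R[i] compares real parts and forces equal imaginary parts; the
   trace is real, so this is the usual inequality between reals. *)
Definition within_power (p : 'I_L -> 'I_K -> R) : Prop :=
  forall i k, \tr ((V i k)^t* *m V i k) <= (p i k)%:C.

Definition assignment (pi : {perm 'I_K}) : Prop := forall k, pi k != k.

(* Column spaces are compared as the row spaces of the transposes. *)
Definition gia_aligned (pi : {perm 'I_K}) : Prop :=
  forall k i j,
    ((H i k (pi k) *m V i k)^T :=: (H j k (pi k) *m V j k)^T)%MS.

Definition nulls_inter_user : Prop :=
  forall i j k, j != i -> (U i k)^t* *m H j k k *m V j k = 0.

Definition nulls_inter_cell : Prop :=
  forall i k m l, l != k -> (U i k)^t* *m H m l k *m V m l = 0.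

Definition rank_condition : Prop :=
  forall i k, \rank ((U i k)^t* *m H i k k *m V i k) = ds.

End Network.

(* Main.v *)
Require Import Defs.
From HB Require Import structures.
From mathcomp Require Import all_boot all_order all_algebra perm zify.
From mathcomp Require Import all_classical all_reals all_analysis.
From mathcomp Require Import measurable_realfun complex.

Set Implicit Arguments.
Unset Strict Implicit.
Unset Printing Implicit Defensive.

Import Order.TTheory GRing.Theory Num.Theory.
Local Open Scope classical_set_scope.
Local Open Scope ring_scope.
Local Open Scope complex_scope.

(** Fix any derangement pi.  At BS pi(k) the transmit vectors of cell k that
produce the same received vector for all L users form the kernel of an explicit
matrix; when all channels have rank min(N_B, N_U), counting dimensions yields
d_s of them whose common image has rank d_s.  These precoders depend only on the
channels from each cell k to BS pi(k).  At BS k the aligned cell then occupies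
d_s dimensions and the K - 1 other cells L d_s each, at most N_B in total, and
the channels of those other cells to BS k do not enter any precoder, so a
suitable choice of them makes all these signals independent.

Genericity is propagated without any general statement on zero sets of
polynomials.  The minors involved are affine in each free channel entry.  If
[a] and [b] are measurable for the other entries and [z] is independent of them
with a diffuse law, then almost surely [a z + b] vanishes only if [a = b = 0].
Substituting random entries one at a time turns a deterministic choice for which
a minor is nonzero into its almost sure nonvanishing.  Since precoders have to
be measurable, they are taken in a finite family of rational functions of the
channels, indexed by choices of minors. *)

(** * Measurability and independence *)

Lemma normal_prob_set1 (R : realType) (m s x : R) :
  normal_prob m s [set x] = 0%E.
Proof. by rewrite /normal_prob integral_set1. Qed.

Section ComplexMeasurability.
Context (R : realType) (d : measure_display) (T : measurableType d).

Definition cmeasurable (f : T -> R[i]) : Prop :=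
  measurable_fun setT (fun t => complex.Re (f t)) /\
  measurable_fun setT (fun t => complex.Im (f t)).

Implicit Types f g : T -> R[i].

Lemma cmeasurable_cst c : cmeasurable (fun=> c).
Proof. by split; exact: measurable_cst. Qed.

Lemma cmeasurableD f g :
  cmeasurable f -> cmeasurable g -> cmeasurable (fun t => f t + g t).
Proof.
move=> [f1 f2] [g1 g2]; split.
- rewrite (_ : (fun t => _) = (fun t => complex.Re (f t) + complex.Re (g t))).
    exact: measurable_funD.
  by apply/funext => t; case: (f t) (g t) => [? ?] [].
- rewrite (_ : (fun t => _) = (fun t => complex.Im (f t) + complex.Im (g t))).
    exact: measurable_funD.
  by apply/funext => t; case: (f t) (g t) => [? ?] [].
Qed.

Lemma cmeasurableM f g :
  cmeasurable f -> cmeasurable g -> cmeasurable (fun t => f t * g t).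
Proof.
move=> [f1 f2] [g1 g2]; split.
- rewrite (_ : (fun t => _) = (fun t => complex.Re (f t) * complex.Re (g t) -
      complex.Im (f t) * complex.Im (g t))).
    by apply: measurable_funB; exact: measurable_funM.
  by apply/funext => t; case: (f t) (g t) => [? ?] [].
- rewrite (_ : (fun t => _) = (fun t => complex.Re (f t) * complex.Im (g t) +
      complex.Im (f t) * complex.Re (g t))).
    by apply: measurable_funD; exact: measurable_funM.
  by apply/funext => t; case: (f t) (g t) => [? ?] [].
Qed.

Lemma cmeasurableN f : cmeasurable f -> cmeasurable (fun t => - f t).
Proof.
move=> mf; rewrite (_ : (fun t => - f t) = (fun t => -1 * f t)).
  by apply: cmeasurableM => //; exact: cmeasurable_cst.
by apply/funext => t; rewrite mulN1r.
Qed.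

Lemma cmeasurableV f : cmeasurable f -> cmeasurable (fun t => (f t)^-1).
Proof.
move=> [f1 f2].
pose q t := complex.Re (f t) ^+ 2 + complex.Im (f t) ^+ 2.
(* Reciprocals are handled as the real power -1, which agrees with the inverse on nonnegative reals,
   including the value 0 at 0. *)
have mq : measurable_fun setT (fun t => (q t)^-1).
  rewrite (_ : (fun t => _) = (@powR R ^~ (-1)) \o q).
    apply: measurableT_comp; first exact: measurable_powR.
    by apply: measurable_funD; exact: measurable_funX.
  by apply/funext => t /=; rewrite powR_inv1// addr_ge0 ?sqr_ge0.
split.
- rewrite (_ : (fun t => _) = (fun t => complex.Re (f t) * (q t)^-1)).
    exact: measurable_funM.
  by apply/funext => t; rewrite /q; case: (f t).
- rewrite (_ : (fun t => _) = (fun t => (- complex.Im (f t)) * (q t)^-1)).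
    by apply: measurable_funM => //; exact: measurable_funN.
  by apply/funext => t; rewrite /q; case: (f t) => ? ? /=; rewrite mulNr.
Qed.

Lemma cmeasurable_sum (I : Type) (r : seq I) (F : I -> T -> R[i]) :
  (forall i, cmeasurable (F i)) -> cmeasurable (fun t => \sum_(i <- r) F i t).
Proof.
move=> mF; elim: r => [|i r IH].
  rewrite (_ : (fun t => _) = (fun=> 0)); first exact: cmeasurable_cst.
  by apply/funext => t; rewrite big_nil.
rewrite (_ : (fun t => _) = (fun t => F i t + \sum_(i <- r) F i t)).
  exact: cmeasurableD.
by apply/funext => t; rewrite big_cons.
Qed.

Lemma cmeasurable_prod (I : Type) (r : seq I) (F : I -> T -> R[i]) :
  (forall i, cmeasurable (F i)) -> cmeasurable (fun t => \prod_(i <- r) F i t).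
Proof.
move=> mF; elim: r => [|i r IH].
  rewrite (_ : (fun t => _) = (fun=> 1)); first exact: cmeasurable_cst.
  by apply/funext => t; rewrite big_nil.
rewrite (_ : (fun t => _) = (fun t => F i t * \prod_(i <- r) F i t)).
  exact: cmeasurableM.
by apply/funext => t; rewrite big_cons.
Qed.

Definition mxmeasurable m n (A : T -> 'M[R[i]]_(m, n)) : Prop :=
  forall i j, cmeasurable (fun t => A t i j).

Lemma mxmeasurable_cst m n (A : 'M[R[i]]_(m, n)) : mxmeasurable (fun=> A).
Proof. by move=> i j; exact: cmeasurable_cst. Qed.

Lemma mxmeasurableB m n (A B : T -> 'M[R[i]]_(m, n)) :
  mxmeasurable A -> mxmeasurable B -> mxmeasurable (fun t => A t - B t).
Proof.
move=> mA mB i j; rewrite (_ : (fun t => _) = (fun t => A t i j + - B t i j)).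
  by apply: cmeasurableD => //; exact: cmeasurableN.
by apply/funext => t; rewrite !mxE.
Qed.

Lemma mxmeasurableM m n p (A : T -> 'M[R[i]]_(m, n)) (B : T -> 'M[R[i]]_(n, p)) :
  mxmeasurable A -> mxmeasurable B -> mxmeasurable (fun t => A t *m B t).
Proof.
move=> mA mB i j; rewrite (_ : (fun t => _) = (fun t => \sum_k A t i k * B t k j)).
  by apply: cmeasurable_sum => k; exact: cmeasurableM.
by apply/funext => t; rewrite !mxE.
Qed.

Lemma mxmeasurable_sub m n m' n' (f : 'I_m' -> 'I_m) (g : 'I_n' -> 'I_n)
    (A : T -> 'M[R[i]]_(m, n)) :
  mxmeasurable A -> mxmeasurable (fun t => mxsub f g (A t)).
Proof.
move=> mA i j; rewrite (_ : (fun t => _) = (fun t => A t (f i) (g j))) //.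
by apply/funext => t; rewrite mxE.
Qed.

Lemma mxmeasurable_tr m n (A : T -> 'M[R[i]]_(m, n)) :
  mxmeasurable A -> mxmeasurable (fun t => (A t)^T).
Proof.
move=> mA i j; rewrite (_ : (fun t => _) = (fun t => A t j i)) //.
by apply/funext => t; rewrite mxE.
Qed.

Lemma cmeasurable_det n (A : T -> 'M[R[i]]_n) :
  mxmeasurable A -> cmeasurable (fun t => \det (A t)).
Proof.
move=> mA; apply: cmeasurable_sum => s; apply: cmeasurableM.
  exact: cmeasurable_cst.
exact: cmeasurable_prod.
Qed.

(* Unlike [invmx], this inverse needs no case distinction to be measurable. *)
Lemma mxmeasurable_inv n (A : T -> 'M[R[i]]_n) :
  mxmeasurable A -> mxmeasurable (fun t => (\det (A t))^-1 *: \adj (A t)).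
Proof.
move=> mA i j.
rewrite (_ : (fun t => _) = (fun t => (\det (A t))^-1 *
    ((-1) ^+ (j + i) * \det (row' j (col' i (A t)))))).
  apply: cmeasurableM; first exact/cmeasurableV/cmeasurable_det.
  apply: cmeasurableM; first exact: cmeasurable_cst.
  apply: cmeasurable_det => a b.
  rewrite (_ : (fun t => _) = (fun t => A t (lift j a) (lift i b))) //.
  by apply/funext => t; rewrite !mxE.
by apply/funext => t; rewrite !mxE.
Qed.

End ComplexMeasurability.

(** * Coincidence of independent variables *)

Section Independence.
Context (R : realType) (d : measure_display) (T : measurableType d).
Context (P : probability T R).
Local Open Scope ereal_scope.

(** By independence the joint law is the product of the two laws. By Fubini the diagonal is then
    null: each of its sections is a singleton, which the diffuse law of [X] does not charge. *)
Lemma independent_eq_null (X W : T -> R) :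
  measurable_fun setT X -> measurable_fun setT W ->
  (forall r, P (X @^-1` [set r]) = 0) ->
  (forall B B', measurable B -> measurable B' ->
     P (X @^-1` B `&` W @^-1` B') = P (X @^-1` B) * P (W @^-1` B')) ->
  P.-negligible [set t | X t = W t].
Proof.
move=> mX mW X0 indep.
have mD : measurable [set z : R * R | z.1 = z.2].
  rewrite (_ : [set _ | _] = [set: R * R] `&`
      (fun z => z.1 - z.2)%R @^-1` [set 0%R]).
    apply: (@measurable_funB _ _ R _ fst snd) => //.
  by apply/seteqP; split=> z /=; [move=> ->; rewrite subrr|
    move=> [_ /eqP]; rewrite subr_eq0 => /eqP].
have mXW : measurable_fun setT (fun t => (W t, X t)) by exact: measurable_fun_pair.
apply/negligibleP.
  rewrite (_ : [set _ | _] = setT `&` (fun t => (W t, X t)) @^-1` [set z : R * R | z.1 = z.2]).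
    exact: mXW.
  by apply/seteqP; split=> t //= [].
pose Xm : {mfun T >-> R} := mfun_Sub (mem_set mX).
pose Wm : {mfun T >-> R} := mfun_Sub (mem_set mW).
pose XWm : {mfun T >-> (R * R)%type} := mfun_Sub (mem_set mXW).
have := @product_measure_unique _ _ _ _ R (distribution P Wm) (distribution P Xm)
  (distribution P XWm).
move=> /(_ _ _ mD) XWE.
transitivity (distribution P XWm [set z : R * R | z.1 = z.2]).
  by congr (P _); apply/seteqP; split => t /= ->.
rewrite -XWE; last first.
  move=> A B mA mB; rewrite muleC -indep// setIC; congr (P _).
rewrite /product_measure1 integral0_eq// => x _ /=.
rewrite -[RHS](X0 x); congr (P _); apply/seteqP; split=> t /=.
  by move/xsectionP => /= <-.
by move=> E; apply/xsectionP => /=.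
Qed.

End Independence.

Section GeneratedSigmaAlgebra.
Context (T : Type) (G : set (set T)).

Let g_sigmaP := (@sigma_algebraP T setT <<s G >> (fun _ _ => @subsetT _ _)).1
  (smallest_sigma_algebra _ _).

Lemma g_sigma_setT : <<s G >> setT.
Proof. by have [] := g_sigmaP. Qed.

Lemma g_sigma_setI : setI_closed <<s G >>.
Proof. by have [_ _ _] := g_sigmaP. Qed.

End GeneratedSigmaAlgebra.

(** * Multi-affine functions of independent diffuse variables *)

Section IndependentFamily.
Context (R : realType) (d : measure_display) (T : measurableType d).
Context (P : probability T R) (I : finType) (Z : I -> T -> R[i]).
Hypothesis mZ : forall i, cmeasurable (Z i).
Hypothesis Z_indep : mutually_independent P (fun i => sigma_complex (Z i)).
Hypothesis Z_diffuse : forall i r, P [set t | complex.Re (Z i t) = r] = 0%E.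

Definition sigma_others (j : I) : set (set T) :=
  \bigcup_(i in [set i | i != j]) sigma_complex (Z i).

Lemma sigma_complex_measurable i : sigma_complex (Z i) `<=` measurable.
Proof.
apply: smallest_sub; first exact: sigma_algebra_measurable.
by move=> A [] [B mB <-]; [apply: (mZ i).1|apply: (mZ i).2].
Qed.

Lemma sigma_others_measurable j : <<s sigma_others j >> `<=` measurable.
Proof.
apply: smallest_sub; first exact: sigma_algebra_measurable.
by move=> A [i _]; exact: sigma_complex_measurable.
Qed.

(** Finite rectangles in the coordinates other than [j]: a generating family stable under
    intersection, as uniqueness of measures requires. *)
Let pi_others (j : I) : set (set T) := [set A | exists2 E : I -> set T,
  (forall i, sigma_complex (Z i) (E i)) &
  A = \bigcap_(i in [set` [set~ j]%SET]) E i].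

(** For fixed [B], both sides are finite measures in [A]. They agree on the pi-system [pi_others j],
    hence on the sigma-algebra it generates. *)
Lemma independent_others j (B A : set T) : sigma_complex (Z j) B ->
  <<s sigma_others j >> A -> P (A `&` B) = (P B * P A)%E.
Proof.
move=> sB sA.
have mB : measurable B by exact: sigma_complex_measurable sB.
have pB : (0 <= fine (P B))%R by rewrite fine_ge0.
have fB : (fine (P B))%:E = P B by rewrite fineK// fin_num_measure.
have m2E X : mscale (NngNum pB) P X = (P B * P X)%E by rewrite /mscale /= fB.
have sP : <<s sigma_others j >> `<=` <<s pi_others j >>.
  apply: smallest_sub; first exact: smallest_sigma_algebra.
  move=> X [i /= ij sX]; apply: sub_sigma_algebra.
  exists (fun i' => if i' == i then X else setT).
    by move=> i'; case: eqP => [->//|_]; exact: g_sigma_setT.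
  apply/seteqP; split=> t.
    by move=> Xt i' _; case: ifP.
  by move=> /(_ i) /=; rewrite eqxx; apply; rewrite !inE.
have TE : [set X | pi_others j X /\ X `<=` setT] = pi_others j.
  by apply/seteqP; split => X => [[]//|]; split.
have mpi : pi_others j `<=` measurable.
  move=> X [E sE ->]; apply: fin_bigcap_measurable; first exact: finite_finset.
  by move=> i _; exact: sigma_complex_measurable (sE i).
have := @g_sigma_algebra_measure_unique_trace _ R T (pi_others j) setT.
rewrite TE.
move=> /(_ measurableT mpi _ (mrestr P mB) (mscale (NngNum pB) P)).
rewrite -m2E; apply => //.
- move=> X Y [E sE ->] [E' sE' ->]; exists (fun i => E i `&` E' i).
    by move=> i; exact: (g_sigma_setI (sE i) (sE' i)).
  by rewrite bigcapI.
- by rewrite [RHS]m2E [LHS](_ : _ = P ([set: T] `&` B))// setTI probability_setT mule1.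
- move=> X [E sE XE]; rewrite [RHS]m2E [LHS](_ : _ = P (X `&` B))//.
  (* Putting [B] in coordinate [j] makes the intersection a rectangle over all of [I], so mutual
     independence factors it. *)
  pose E' i := if i == j then B else E i.
  have sE' i : sigma_complex (Z i) (E' i) by rewrite /E'; case: eqP => [->|].
  have -> : X `&` B = \bigcap_(i in [set` [set: I]%SET]) E' i.
    apply/seteqP; split=> t.
      move=> [Xt Bt] i _; rewrite /E'; case: eqP => // /eqP ij.
      by move: Xt; rewrite XE => /(_ i); apply; rewrite /= !inE.
    move=> E't; split; last by have := E't j; rewrite /E' eqxx; apply => /=; rewrite inE.
    rewrite XE => i /=; rewrite !inE => ij.
    by have := E't i; rewrite /E' (negbTE ij); apply => /=; rewrite inE.
  rewrite (Z_indep (fun i _ => sE' i)) XE (Z_indep (fun i _ => sE i)).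
  rewrite (big_setD1 j) ?inE//= /E' eqxx; congr (_ * _)%E.
  by apply: eq_big => [i|i]; rewrite !inE ?andbT// => /negPf ->.
- by rewrite [X in (X < _)%E](_ : _ = P ([set: T] `&` B))// setTI ltey_eq fin_num_measure.
- exact: sP.
Qed.

(** Where [a] is nonzero, a root means [Z j = - b / a]. Comparing real parts equates a diffuse
    variable with one measurable for the other coordinates, a null event. *)
Lemma affine_null j (a b : T -> R[i]) :
  @cmeasurable R _ (g_sigma_algebraType (sigma_others j)) a ->
  @cmeasurable R _ (g_sigma_algebraType (sigma_others j)) b ->
  P.-negligible [set t | a t != 0 /\ a t * Z j t + b t = 0].
Proof.
move=> ma mb.
have [mW _] := cmeasurableM (cmeasurableN mb) (cmeasurableV ma).
set W := (fun t => complex.Re _) in mW.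
have sub B : measurable B -> <<s sigma_others j >> (W @^-1` B).
  by move=> mB; have := mW measurableT B mB; rewrite setTI.
have mWT : measurable_fun [set: T] W.
  by move=> _ B mB; rewrite setTI; exact: sigma_others_measurable (sub B mB).
apply: (negligibleS (A := [set t | complex.Re (Z j t) = W t])).
  move=> t /= [a0 /eqP]; rewrite addr_eq0 => /eqP E.
  by rewrite /W -E [X in X / _]mulrC mulfK.
apply: independent_eq_null => //; first exact: (mZ j).1.
  by move=> r; exact: Z_diffuse.
move=> B B' mB mB'; rewrite setIC (@independent_others j)//; last exact: sub.
by apply: sub_sigma_algebra; left; exists B => //; rewrite setTI.
Qed.

Definition subst (x : I -> R[i]) (j : I) (h : R[i]) : I -> R[i] :=
  fun i => if i == j then h else x i.

(** Affinity is stated by interpolation between 0 and 1, so that slope and intercept are built from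
    values of [f] and inherit its measurability. *)
Definition affine_in (f : (I -> R[i]) -> R[i]) (j : I) : Prop := forall x h,
  f (subst x j h) = (1 - h) * f (subst x j 0) + h * f (subst x j 1).

(** Quantifying over all measurable spaces allows [T] to be equipped with the smaller sigma-algebra
    of the coordinates other than [j]. *)
Definition measurable_op (f : (I -> R[i]) -> R[i]) : Prop :=
  forall d' (T' : measurableType d') (x : I -> T' -> R[i]),
    (forall i, cmeasurable (x i)) -> cmeasurable (fun t => f (x^~ t)).

Definition partial_subst (Q : {set I}) (e : I -> bool) (x : I -> R[i]) : I -> R[i] :=
  fun i => if i \in Q then (e i)%:R else x i.

Lemma cmeasurable_sigma_others j i : i != j ->
  @cmeasurable R _ (g_sigma_algebraType (sigma_others j)) (Z i).
Proof.
move=> ij; split=> _ B mB; rewrite setTI; apply: sub_sigma_algebra;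
  exists i => //; apply: sub_sigma_algebra; [left|right];
  by exists B => //; rewrite setTI.
Qed.

Lemma subst_partial_subst (Q : {set I}) e x j h :
  subst (partial_subst Q e x) j h = subst (partial_subst (Q :\ j) e x) j h.
Proof.
apply/funext => i; rewrite /subst /partial_subst; case: eqP => // /eqP ij.
by rewrite !inE ij.
Qed.

(* The coordinates in [Q] are replaced by the random ones one at a time: each
step is affine in a variable independent of all the others. *)
Lemma ae_partial_subst (f : (I -> R[i]) -> R[i]) (Q : {set I}) (e : I -> bool) :
  measurable_op f -> (forall j, j \in Q -> affine_in f j) ->
  {ae P, forall t, f (partial_subst Q e (Z^~ t)) != 0 -> f (Z^~ t) != 0}.
Proof.
move=> mf; elim: {Q}_.+1 {-2}Q (ltnSn #|Q|) => // n IH Q Qn fQ.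
have [->|[j jQ]] := set_0Vmem Q.
  by apply: aeW => t; rewrite (_ : partial_subst _ _ _ = (Z^~ t))//;
    apply/funext => i; rewrite /partial_subst inE.
move: Qn; rewrite (cardsD1 j) jQ => Qn.
have IHQ := IH (Q :\ j)%SET Qn
  (fun i iQ => fQ i (fintype.subsetP (subD1set Q j) i iQ)).
pose X t := partial_subst (Q :\ j) e (Z^~ t).
(* With coordinate [j] frozen at a constant, only the other random coordinates enter. *)
have mfX c : @cmeasurable R _ (g_sigma_algebraType (sigma_others j))
    (fun t => f (subst (X t) j c)).
  apply: (mf _ (g_sigma_algebraType (sigma_others j))
    (fun i t => subst (X t) j c i)) => i.
  have [ij|ij] := eqVneq i j.
    rewrite (_ : (fun t => _) = fun=> c); first exact: cmeasurable_cst.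
    by apply/funext => t; rewrite /subst ij eqxx.
  have [iQ|iQ] := boolP (i \in Q :\ j)%SET.
    rewrite (_ : (fun t => _) = fun=> (e i)%:R); first exact: cmeasurable_cst.
    by apply/funext => t; rewrite /subst (negbTE ij) /X /partial_subst iQ.
  rewrite (_ : (fun t => _) = Z i); first exact: cmeasurable_sigma_others.
  by apply/funext => t; rewrite /subst (negbTE ij) /X /partial_subst (negbTE iQ).
have null := affine_null
  (cmeasurableD (mfX 1) (cmeasurableN (mfX 0))) (mfX 0).
have fE t c : f (subst (X t) j c) =
    (f (subst (X t) j 1) - f (subst (X t) j 0)) * c + f (subst (X t) j 0).
  rewrite fQ// mulrBl mul1r mulrBl ![_ * c]mulrC [LHS]addrC -addrA.
  by rewrite [- _ + _]addrC.
have step : {ae P, forall t, f (partial_subst Q e (Z^~ t)) != 0 -> f (X t) != 0}.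
  apply: negligibleS null => t /= /not_implyP[fQe /negP]; rewrite negbK => /eqP fX.
  have XE : X t = subst (X t) j (Z j t).
    apply/funext => i; rewrite /subst; case: eqP => // ->.
    by rewrite /X /partial_subst !inE eqxx.
  have QE : partial_subst Q e (Z^~ t) = subst (X t) j (e j)%:R.
    by rewrite -subst_partial_subst; apply/funext => i;
      rewrite /subst /partial_subst; case: eqP => // ->; rewrite jQ.
  (* If the slope vanished, [f] would be constant along [j], so its zero at [X t] would also be a
     zero at the substituted point. *)
  rewrite -fE -XE fX; split=> //; apply: contra fQe => /eqP a0.
  by move: fX; rewrite XE (fE t (Z j t)) QE (fE t (e j)%:R) a0 !mul0r !add0r => ->.
by apply: filterS2 step IHQ => t stept IHt /stept/IHt.
Qed.

(** A function affine in one coordinate and zero at both 0 and 1 is zero along that whole line.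
    Hence each coordinate of [Q] can in turn be moved to 0 or 1 while keeping a nonzero value. *)
Lemma partial_subst_vertex (f : (I -> R[i]) -> R[i]) (Q : {set I}) x :
  (forall j, j \in Q -> affine_in f j) -> f x != 0 ->
  exists e : {ffun I -> bool}, f (partial_subst Q e x) != 0.
Proof.
elim: {Q}_.+1 {-2}Q (ltnSn #|Q|) => // n IH Q Qn fQ fx.
have [->|[j jQ]] := set_0Vmem Q.
  exists [ffun=> true]; rewrite (_ : partial_subst _ _ _ = x)//.
  by apply/funext => i; rewrite /partial_subst inE.
move: Qn; rewrite (cardsD1 j) jQ => Qn.
have [e fe] := IH (Q :\ j)%SET Qn
  (fun i iQ => fQ i (fintype.subsetP (subD1set Q j) i iQ)) fx.
set y := partial_subst _ _ _ in fe.
have yE (b : bool) : subst y j b%:R =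
    partial_subst Q [ffun i => if i == j then b else e i] x.
  by rewrite -subst_partial_subst; apply/funext => i;
    rewrite /subst /partial_subst !ffunE; case: eqP => // ->; rewrite jQ.
have yj : y = subst y j (y j).
  by apply/funext => i; rewrite /subst; case: eqP => // ->.
have [f0|f0] := eqVneq (f (subst y j 0)) 0.
  exists [ffun i => if i == j then true else e i]; rewrite -yE.
  apply: contra fe => /eqP f1.
  by rewrite yj fQ// f0 [f (subst y j 1)]f1 !mulr0 addr0.
by exists [ffun i => if i == j then false else e i]; rewrite -yE.
Qed.

(** The points [x] may be uncountably many and may depend on [t]. Passing to a vertex of the 0/1
    cube leaves finitely many null sets to discard. *)
Lemma ae_nonvanishing (f : (I -> R[i]) -> R[i]) (F : {set I}) :
  measurable_op f -> (forall j, j \in F -> affine_in f j) ->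
  {ae P, forall t, forall x, (forall i, i \notin F -> x i = Z i t) ->
    f x != 0 -> f (Z^~ t) != 0}.
Proof.
move=> mf fF.
have : {ae P, forall t, forall e : {ffun I -> bool},
    f (partial_subst F e (Z^~ t)) != 0 -> f (Z^~ t) != 0}.
  by apply: filter_forall => e; exact: ae_partial_subst.
apply: filterS => t fe x xZ /(partial_subst_vertex fF)[e].
rewrite (_ : partial_subst F e x = partial_subst F e (Z^~ t)); first exact: fe.
by apply/funext => i; rewrite /partial_subst; case: ifPn => // /xZ.
Qed.

End IndependentFamily.

(** * The channel entries as one independent diffuse family *)

Section Rayleigh.
Context (R : realType) (d : measure_display) (T : measurableType d).
Context (P : probability T R) (K L NB NU : nat).
Context (Hbar : 'I_L -> 'I_K -> 'I_K -> T -> 'M[R[i]]_(NB, NU)).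
Hypothesis Hbar_rayleigh : rayleigh_fading P Hbar.

(* [((i, k, l), (a, b))] indexes entry [(a, b)] of the channel from user [(i, k)] to BS [l]. *)
Definition entry : finType := (('I_L * 'I_K * 'I_K) * ('I_NB * 'I_NU))%type.

Definition entry_val (e : entry) (t : T) : R[i] :=
  Hbar e.1.1.1 e.1.1.2 e.1.2 t e.2.1 e.2.2.

Lemma entry_cmeasurable e : cmeasurable (entry_val e).
Proof.
have [_ _ gauss] := Hbar_rayleigh.
by have [[mX _] [mY _] _] := gauss e.1.1.1 e.1.1.2 e.1.2 e.2.1 e.2.2; split.
Qed.

Lemma entry_diffuse e r : P [set t | complex.Re (entry_val e t) = r] = 0%E.
Proof.
have [_ _ gauss] := Hbar_rayleigh.
have [[_ lawX] _ _] := gauss e.1.1.1 e.1.1.2 e.1.2 e.2.1 e.2.2.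
by have := lawX [set r] (measurable_set1 r); rewrite normal_prob_set1.
Qed.

(** Independence is given at two levels, between matrices and inside each matrix; grouping the
    events by matrix multiplies the two factorizations. *)
Lemma entry_independent :
  mutually_independent P (fun e => sigma_complex (entry_val e)).
Proof.
have [indep_user indep_entry _] := Hbar_rayleigh.
move=> J E sE.
(* Padding with the full event, of probability 1, lets the product run over complete matrices. *)
pose E' e := if e \in J then E e else setT.
have sE' e : sigma_complex (entry_val e) (E' e).
  rewrite /E'; case: ifPn => [/sE//|_]; exact: g_sigma_setT.
pose F (u : 'I_L * 'I_K * 'I_K) :=
  \bigcap_(ab in [set` [set: 'I_NB * 'I_NU]%SET]) E' (u, ab).
have sF u : sigma_matrix (Hbar u.1.1 u.1.2 u.2) (F u).
  rewrite /F -bigsetI_fset_set; last exact: finite_finset.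
  elim/big_ind : _ => [|A B sA sB|ab _]; first exact: g_sigma_setT.
    exact: g_sigma_setI.
  apply: sub_sigma_algebra; exists ab => //.
  exact: sE' (u, ab).
have -> : \bigcap_(e in [set` J]) E e =
    \bigcap_(u in [set` [set: 'I_L * 'I_K * 'I_K]%SET]) F u.
  apply/seteqP; split=> t Et.
    move=> u _ ab _; rewrite /E'; case: ifPn => // uJ.
    exact: Et.
  move=> [u ab] /= uJ; have /(_ u) := Et; rewrite /= inE => /(_ isT ab).
  by rewrite /= inE /E' uJ => /(_ isT).
rewrite (indep_user _ _ (fun u _ => sF u)).
under eq_bigr => u _.
  rewrite /F (indep_entry u.1.1 u.1.2 u.2 _ (fun ab => E' (u, ab))
    (fun ab _ => sE' (u, ab))).
  over.
rewrite pair_big/= [RHS]big_mkcond/=; apply: eq_big => [[u ab]|[u ab] _] /=.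
  by rewrite !inE.
by rewrite /E'; case: ifP => // _; rewrite probability_setT.
Qed.

Definition entries (t : T) : entry -> R[i] := fun e => entry_val e t.

Lemma rayleigh_ae_nonvanishing (f : (entry -> R[i]) -> R[i]) (F : {set entry}) :
  measurable_op f -> (forall j, j \in F -> affine_in f j) ->
  {ae P, forall t, forall x, (forall e, e \notin F -> x e = entries t e) ->
    f x != 0 -> f (entries t) != 0}.
Proof.
exact: (ae_nonvanishing entry_cmeasurable entry_independent entry_diffuse).
Qed.

End Rayleigh.

(** * Linear algebra of alignment and zero forcing *)

Section MatrixLemmas.
Context (F : fieldType).

Lemma row_free_rowsub m m' n (A : 'M[F]_(m, n)) (g : 'I_m' -> 'I_m) :
  injective g -> row_free A -> row_free (rowsub g A).
Proof.
move=> g_inj /row_freeP[B AB]; apply/row_freeP; exists (B *m colsub g 1%:M).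
rewrite mul_rowsub_mx mulmxA AB mul1mx.
by apply/matrixP => i j; rewrite !mxE (inj_eq g_inj).
Qed.

Lemma rank_ge_rowsub m n r (A : 'M[F]_(m, n)) : (r <= \rank A)%N ->
  exists s : 'I_m ^ r, row_free (rowsub s A).
Proof.
move=> rA; exists (finfun (maxrankfun A \o widen_ord rA)).
rewrite mxsub_ffunl rowsub_comp; apply: row_free_rowsub.
  by move=> i j /(congr1 val) /= /val_inj.
exact: maxrowsub_free.
Qed.

(** Codimensions are subadditive under intersection; written without subtraction, for natural
    numbers. *)
Lemma mxrank_bigcap (I : Type) (r : seq I) n (A : I -> 'M[F]_n) :
  (\sum_(i <- r) \rank (A i) + n <= \rank (\bigcap_(i <- r) A i)%MS + size r * n)%N.
Proof.
elim: r => [|i r IH]; first by rewrite !big_nil mxrank1 mul0n addn0.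
rewrite !big_cons /=; have := mxrank_sum_cap (A i) (\bigcap_(j <- r) A j)%MS.
have := rank_leq_col (A i + \bigcap_(j <- r) A j)%MS.
set a := \rank (A i + _)%MS; set b := \rank (A i :&: _)%MS.
rewrite mulSn; lia.
Qed.

(** Only row [a] varies, and injectivity of [sel] makes it occur at most once in the minor. The
    determinant is linear in that row, or constant if the row is not selected. *)
Lemma det_rowsub_affine m n (A B : 'M[F]_(m, n)) (sel : 'I_n -> 'I_m) a h :
  injective sel -> (forall i j, i != a -> A i j = B i j) ->
  \det (rowsub sel ((1 - h) *: A + h *: B)) =
  (1 - h) * \det (rowsub sel A) + h * \det (rowsub sel B).
Proof.
move=> sel_inj AB.
have comb i j : i != a -> ((1 - h) *: A + h *: B) i j = A i j.
  by move=> ia; rewrite !mxE -AB// -mulrDl subrK mul1r.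
have [i0 /eqP sel_i0|sel_a] := pickP (fun i => sel i == a).
  have ne i : sel (lift i0 i) != a.
    by rewrite -sel_i0 (inj_eq sel_inj) eq_sym neq_lift.
  apply: (@determinant_multilinear _ _ _ _ _ i0).
  - by apply/rowP => j; rewrite !mxE.
  - by apply/matrixP => i j; rewrite !mxE -!AB// -mulrDl subrK mul1r.
  - by apply/matrixP => i j; rewrite !mxE -!AB// -mulrDl subrK mul1r.
have -> : rowsub sel ((1 - h) *: A + h *: B) = rowsub sel A.
  by apply/matrixP => i j; rewrite mxE comb ?sel_a// mxE.
have -> : rowsub sel B = rowsub sel A.
  by apply/matrixP => i j; rewrite !mxE AB ?sel_a.
by rewrite -mulrDl subrK mul1r.
Qed.

(* An r x r minor of [M]: its rows and its columns. *)
Definition minor_choice (m n : nat) : finType :=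
  {r : 'I_m.+1 & ('I_m ^ r * 'I_n ^ r)%type}.

(* Written without [invmx], so that its entries are rational functions of those of [M]. *)
Definition minor_ginv m n (S : minor_choice m n) (M : 'M[F]_(m, n)) : 'M[F]_(n, m) :=
  let B := mxsub (tagged S).1 (tagged S).2 M in
  colsub (tagged S).2 1%:M *m ((\det B)^-1 *: \adj B) *m rowsub (tagged S).1 1%:M.

(** Take a maximal free set of rows, then columns making the minor [B] invertible. Writing
    [M = X *m rowsub f M], the selected columns are [X *m B], and [B] cancels against its
    inverse. *)
Lemma minor_ginvP m n (M : 'M[F]_(m, n)) :
  exists S, M *m minor_ginv S M *m M = M.
Proof.
have rm : (\rank M < m.+1)%N by rewrite ltnS rank_leq_row.
pose f := maxrankfun M.
have fM : row_full (rowsub f M)^T.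
  by rewrite /row_full mxrank_tr; exact: maxrowsub_free.
pose g := fullrankfun fM.
have Bu : mxsub f g M \in unitmx.
  have := fullrowsub_unit fM; rewrite -unitmx_tr.
  by congr (_ \in unitmx); apply/matrixP => i j; rewrite !mxE.
have [X MX] : exists X, M = X *m rowsub f M.
  by apply/submxP; rewrite eq_maxrowsub.
exists (Tagged (fun r : 'I_m.+1 => ('I_m ^ r * 'I_n ^ r)%type) (i := Ordinal rm) (f, g)).
rewrite /minor_ginv /=.
have -> : (\det (mxsub f g M))^-1 *: \adj (mxsub f g M) = invmx (mxsub f g M).
  by rewrite /invmx Bu.
rewrite !mulmxA -mulmxA mul_rowsub_mx mul1mx.
rewrite mulmx_colsub mulmx1.
have -> : colsub g M = X *m mxsub f g M.
  have -> : mxsub f g M = colsub g (rowsub f M) by apply/matrixP => i j; rewrite !mxE.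
  by rewrite mulmx_colsub -MX.
by rewrite mulmxK// -MX.
Qed.

End MatrixLemmas.

(** * Aligned precoders from the kernel of the misalignment map *)

Section Alignment.
Context (F : fieldType) (l NB NU : nat) (H : 'I_l.+1 -> 'M[F]_(NB, NU)).

(* Row [i] of [W] is a (transposed) transmit vector of user [i]. *)
Definition misalignment (W : 'M[F]_(l.+1, NU)) : 'M[F]_(l, NB) :=
  \matrix_(i, b) ((row (lift ord0 i) W *m (H (lift ord0 i))^T) 0 b -
                  (row ord0 W *m (H ord0)^T) 0 b).

Fact misalignment_is_linear : linear misalignment.
Proof.
move=> c W W'; apply/matrixP => i b; rewrite mxE !linearD !linearZ /= !mulmxDl.
by rewrite -!scalemxAl !mxE mulrBr opprD addrACA.
Qed.

HB.instance Definition _ :=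
  GRing.isLinear.Build F _ _ _ misalignment misalignment_is_linear.

Lemma misalignment0P W : misalignment W = 0 ->
  forall i, row i W *m (H i)^T = row ord0 W *m (H ord0)^T.
Proof.
move=> W0 i; have [j ->|-> //] := unliftP ord0 i.
apply/rowP => b; apply/eqP; rewrite -subr_eq0.
by move/matrixP/(_ j b): W0; rewrite !mxE => ->.
Qed.

Definition misalignment_mx : 'M[F]_(l.+1 * NU, l * NB) := lin_mx misalignment.

Context (S : minor_choice (l.+1 * NU) (l * NB)).

(** When [minor_ginv] is a generalized inverse, this is the projector onto the left kernel of
    [misalignment_mx]; for fixed [S] its entries are rational in the channels. *)
Definition aligned_proj : 'M[F]_(l.+1 * NU) :=
  1%:M - misalignment_mx *m minor_ginv S misalignment_mx.

Definition aligned_precoder ds (s : 'I_(l.+1 * NU) ^ ds) (i : 'I_l.+1) : 'M[F]_(NU, ds) :=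
  \matrix_(a, c) vec_mx (row (s c) aligned_proj) i a.

Hypothesis ginvS :
  misalignment_mx *m minor_ginv S misalignment_mx *m misalignment_mx = misalignment_mx.

Lemma aligned_proj_row p i :
  row i (vec_mx (row p aligned_proj)) *m (H i)^T =
  row ord0 (vec_mx (row p aligned_proj)) *m (H ord0)^T.
Proof.
apply: misalignment0P; apply: (can_inj mxvecK).
rewrite -mul_vec_lin vec_mxK linear0 -row_mul mulmxBl mul1mx.
by rewrite -/misalignment_mx ginvS subrr row0.
Qed.

Lemma aligned_precoderE ds (s : 'I_(l.+1 * NU) ^ ds) i :
  H i *m aligned_precoder s i = H ord0 *m aligned_precoder s ord0.
Proof.
apply: trmx_inj; apply/row_matrixP => c; rewrite !trmx_mul !row_mul.
have rowE j : row c (aligned_precoder s j)^T = row j (vec_mx (row (s c) aligned_proj)).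
  by apply/rowP => a; rewrite !mxE.
by rewrite !rowE aligned_proj_row.
Qed.

(** A vector received identically from all users lifts to a tuple of transmit vectors in the kernel.
    The projector fixes that tuple, and reception from user [ord0] returns the vector. *)
Lemma bigcap_sub_aligned :
  (\bigcap_i <<(H i)^T>> <=
   aligned_proj *m lin1_mx (mulmxr (H ord0)^T \o row ord0 \o vec_mx))%MS.
Proof.
apply/rV_subP => g /sub_bigcapmxP gH.
have {gH} /fin_all_exists[y yH] i : exists y : 'rV_NU, g = y *m (H i)^T.
  by apply/submxP; have := gH i isT; rewrite genmxE.
pose W := \matrix_i y i.
have rW i : row i W = y i by rewrite rowK.
have W0 : mxvec W *m misalignment_mx = 0.
  rewrite mul_vec_lin; apply: (canLR vec_mxK); rewrite linear0.
  by apply/matrixP => i b; rewrite mxE !rW -!yH subrr mxE.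
have -> : g = mxvec W *m (aligned_proj *m lin1_mx (mulmxr (H ord0)^T \o row ord0 \o vec_mx)).
  rewrite mulmxA mulmxBr mulmx1 mulmxA W0 mul0mx subr0 mul_rV_lin1 /=.
  by rewrite mxvecK rW -yH.
exact: submxMl.
Qed.

End Alignment.

Lemma exists_aligned_precoder (F : fieldType) l NB NU ds
    (H : 'I_l.+1 -> 'M[F]_(NB, NU)) :
  (forall i, (minn NB NU <= \rank (H i))%N) -> (ds <= NB)%N ->
  (l * NB + ds <= l.+1 * NU)%N ->
  exists S (s : 'I_(l.+1 * NU) ^ ds),
    (forall i, H i *m aligned_precoder H S s i = H ord0 *m aligned_precoder H S s ord0) /\
    row_free (H ord0 *m aligned_precoder H S s ord0)^T.
Proof.
move=> rH dsNB dsNU.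
have [S ginvS] := minor_ginvP (misalignment_mx H).
have rcap : (ds <= \rank (\bigcap_i <<(H i)^T>>)%MS)%N.
  have := mxrank_bigcap (index_enum 'I_l.+1) (fun i => <<(H i)^T>>%MS).
  have -> : size (index_enum 'I_l.+1) = l.+1.
    by rewrite /index_enum -enumT -cardE card_ord.
  move=> rcap.
  have sum_le : (l.+1 * minn NB NU <= \sum_i \rank (<<(H i)^T>>)%MS)%N.
    rewrite -[X in (X * _)%N]card_ord -sum_nat_const leq_sum// => i _.
    by rewrite mxrank_gen mxrank_tr.
  have E := leq_trans (leq_add sum_le (leqnn NB)) rcap.
  (* The common image has dimension at least [l.+1 * minn NB NU - l * NB]. This is [NB] or
     [l.+1 * NU - l * NB], according to the minimum, and both are at least [ds]. *)
  move: E dsNB dsNU; set r := \rank _; rewrite !mulSn; lia.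
have [s sfree] := rank_ge_rowsub (leq_trans rcap (mxrankS (bigcap_sub_aligned H S))).
exists S, s; split; first by move=> i; exact: aligned_precoderE.
suff -> : (H ord0 *m aligned_precoder H S s ord0)^T =
  rowsub s (aligned_proj H S *m lin1_mx (mulmxr (H ord0)^T \o row ord0 \o vec_mx)) by [].
apply/row_matrixP => c; rewrite row_rowsub trmx_mul !row_mul mul_rV_lin1 /=.
by congr (_ *m _); apply/rowP => a; rewrite !mxE.
Qed.

(** * Completion of the received signals and zero forcing *)

Section Decoding.
Context (F : fieldType) (NB ds L K : nat).

Definition other_stream : finType := ('I_L * 'I_K * 'I_ds)%type.

(* [A] spans the aligned interference, [B i k] the signal of user [(i, k)] of a
cell that is not aligned here. *)
Definition received_mx (A : 'M[F]_(NB, ds)) (B : 'I_L -> 'I_K -> 'M[F]_(NB, ds)) :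
    'M[F]_(NB, ds + #|other_stream|) :=
  row_mx A (\matrix_(a, j) B (enum_val j).1.1 (enum_val j).1.2 a (enum_val j).2).

(** The columns of [A] leave a complement of dimension [NB - ds], with room for one basis vector per
    remaining stream. *)
Lemma received_mx_complete (A : 'M[F]_(NB, ds)) :
  row_free A^T -> (ds + L * K * ds <= NB)%N ->
  exists B, row_free (received_mx A B)^T.
Proof.
move=> freeA dsNB.
pose E := col_mx A^T (row_base (A^T)^C)%MS.
have rC : (ds + \rank (A^T)^C%MS)%N = NB.
  by rewrite mxrank_compl (eqP freeA) subnKC// -(eqP freeA) rank_leq_col.
have freeE : row_free E.
  rewrite -row_leq_rank [X in (X <= _)%N]rC /E -addsmxE.
  rewrite (adds_eqmx (eqmx_refl _) (eq_row_base _)).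
  by rewrite -{1}(mxrank1 F NB) mxrankS// sub1mx addsmx_compl_full.
have card_others : #|other_stream| = (L * K * ds)%N.
  by rewrite /other_stream !card_prod !card_ord.
have others_le : (#|other_stream| <= \rank (A^T)^C%MS)%N.
  by rewrite card_others -(leq_add2l ds) rC.
pose C := rowsub (widen_ord others_le) (row_base (A^T)^C)%MS.
exists (fun i k => \matrix_(a, c) C (enum_rank (i, k, c)) a).
have -> : (received_mx A (fun i k => \matrix_(a, c) C (enum_rank (i, k, c)) a))^T =
    col_mx A^T C.
  rewrite tr_row_mx; congr col_mx; apply/matrixP => i j; rewrite !mxE.
  by rewrite -!surjective_pairing enum_valK.
pose g (j : 'I_(ds + #|other_stream|)) : 'I_(ds + \rank (A^T)^C%MS) :=
  match fintype.split j with inl i => lshift _ i | inr i => rshift _ (widen_ord others_le i) end.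
have -> : col_mx A^T C = rowsub g E.
  apply/matrixP => i j; rewrite !mxE /g; case: (fintype.splitP i) => i' _.
    by rewrite -[lshift _ _]/(unsplit (inl i')) unsplitK.
  by rewrite -[rshift _ _]/(unsplit (inr (widen_ord others_le i'))) unsplitK mxE.
apply: row_free_rowsub freeE => i j.
rewrite /g; case: (fintype.splitP i) => i' ii; case: (fintype.splitP j) => j' jj /(congr1 val) /= ij;
  apply: val_inj; rewrite /= ii jj.
- by [].
- by have := ltn_ord i'; rewrite ij ltnNge leq_addr.
- by have := ltn_ord j'; rewrite -ij ltnNge leq_addr.
- by [].
Qed.

Lemma zero_forcing A B : row_free (received_mx A B)^T -> forall i k,
  exists W : 'M[F]_(ds, NB), [/\ W *m A = 0, W *m B i k = 1%:M &
    forall i' k', (i', k') != (i, k) -> W *m B i' k' = 0].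
Proof.
move=> /row_freeP[X DX] i k.
have {DX} XD : X^T *m received_mx A B = 1%:M.
  by rewrite -[received_mx A B]trmxK -trmx_mul DX trmx1.
pose r (c : 'I_ds) : 'I_(ds + #|other_stream|) := rshift ds (enum_rank (i, k, c)).
pose W := rowsub r X^T.
have WD : W *m received_mx A B = rowsub r 1%:M by rewrite mul_rowsub_mx XD.
have WB i' k' c c' : (W *m B i' k') c c' = ((i', k', c') == (i, k, c))%:R.
  have /matrixP/(_ c (rshift ds (enum_rank (i', k', c')))) := WD.
  rewrite mul_mx_row row_mxEr !mxE /r (inj_eq (@rshift_inj _ _)).
  rewrite (inj_eq enum_rank_inj) eq_sym => <-.
  by apply: eq_bigr => a _; rewrite !mxE enum_rankK.
exists W; split.
- apply/matrixP => c c'; have /matrixP/(_ c (lshift _ c')) := WD.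
  rewrite mul_mx_row row_mxEl => ->; rewrite !mxE /r.
  by rewrite eq_sym eq_lrshift.
- by apply/matrixP => c c'; rewrite WB !mxE !xpair_eqE !eqxx /= eq_sym.
- move=> i' k' /negPf ne; apply/matrixP => c c'; rewrite WB mxE.
  by rewrite xpair_eqE ne.
Qed.

End Decoding.

(** * Genericity of the channels *)

Section AlignmentMeasurability.
Context (R : realType) (d : measure_display) (T : measurableType d).

Lemma mxmeasurable_aligned_precoder l NB NU ds
    (H : T -> 'I_l.+1 -> 'M[R[i]]_(NB, NU)) S (s : 'I_(l.+1 * NU) ^ ds) i :
  (forall j, mxmeasurable (fun t => H t j)) ->
  mxmeasurable (fun t => aligned_precoder (H t) S s i).
Proof.
move=> mH.
(* Row [p] of the matrix is the image of the basis vector [delta_mx 0 p], so its entries are linear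
   in the channels. *)
have mN : mxmeasurable (fun t => misalignment_mx (H t)).
  move=> p q; case/mxvec_indexP: q => j b.
  rewrite (_ : (fun t => _) = fun t =>
      ((row (lift ord0 j) (vec_mx (delta_mx 0 p)) *m (H t (lift ord0 j))^T) -
       (row ord0 (vec_mx (delta_mx 0 p)) *m (H t ord0)^T)) 0 b).
    by apply: mxmeasurableB; apply: mxmeasurableM;
      [exact: mxmeasurable_cst|exact: mxmeasurable_tr|
       exact: mxmeasurable_cst|exact: mxmeasurable_tr].
  by apply/funext => t; rewrite /misalignment_mx /lin_mx !mxE mxvecE !mxE.
have mK : mxmeasurable (fun t => aligned_proj (H t) S).
  apply: mxmeasurableB; first exact: mxmeasurable_cst.
  apply: mxmeasurableM => //; rewrite /minor_ginv.
  apply: mxmeasurableM; last exact: mxmeasurable_cst.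
  apply: mxmeasurableM; first exact: mxmeasurable_cst.
  exact/mxmeasurable_inv/mxmeasurable_sub.
move=> a c; rewrite (_ : (fun t => _) = fun t =>
  aligned_proj (H t) S (s c) (mxvec_index i a)); first exact: mK.
by apply/funext => t; rewrite !mxE.
Qed.

Lemma mxmeasurable_received NB ds L K (A : T -> 'M[R[i]]_(NB, ds))
    (B : T -> 'I_L -> 'I_K -> 'M[R[i]]_(NB, ds)) :
  mxmeasurable A -> (forall i k, mxmeasurable (fun t => B t i k)) ->
  mxmeasurable (fun t => received_mx (A t) (B t)).
Proof.
move=> mA mB a j; rewrite -(splitK j); case: (fintype.split j) => j' /=.
  by rewrite (_ : (fun t => _) = fun t => A t a j')//; apply/funext => t; rewrite row_mxEl.
rewrite (_ : (fun t => _) = fun t =>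
  B t (enum_val j').1.1 (enum_val j').1.2 a (enum_val j').2); first exact: mB.
by apply/funext => t; rewrite row_mxEr mxE.
Qed.

End AlignmentMeasurability.

(** * From generic channel entries to precoders and decoders *)

Section Construction.
Context (R : realType) (K l NB NU ds : nat) (pi : {perm 'I_K.+1}).
Local Notation entry := (entry K.+1 l.+1 NB NU).
Local Notation C := R[i].
Implicit Types (x y : entry -> C) (k m : 'I_K.+1) (i : 'I_l.+1).

Definition channel_of x i k m : 'M[C]_(NB, NU) :=
  \matrix_(a, b) x ((i, k, m), (a, b)).

Definition precoder_choice : finType :=
  (minor_choice (l.+1 * NU) (l * NB) * 'I_(l.+1 * NU) ^ ds)%type.

Implicit Type theta : {ffun 'I_K.+1 -> precoder_choice}.

Definition precoder theta x i k : 'M[C]_(NU, ds) :=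
  aligned_precoder (fun j => channel_of x j k (pi k)) (theta k).1 (theta k).2 i.

(** Cell [m] is the one aligned at BS [k], represented by its user [ord0]. The cells [lift m n] are
    all the others, including cell [k] itself when [pi] has no fixed point. *)
Definition received theta x k :=
  let m := (pi^-1)%g k in
  received_mx (channel_of x ord0 m k *m precoder theta x ord0 m)
    (fun i n => channel_of x i (lift m n) k *m precoder theta x i (lift m n)).

(* Entries of the channels along which nothing is aligned: the precoders do not
depend on them. *)
Definition free_entries : {set entry} := [set e : entry | e.1.2 != pi e.1.1.2].

Lemma eq_precoder theta x y : (forall e, e \notin free_entries -> x e = y e) ->
  precoder theta x = precoder theta y.
Proof.
move=> xy; apply/funext => i; apply/funext => k; rewrite /precoder.
have -> // : (fun j => channel_of x j k (pi k)) = fun j => channel_of y j k (pi k).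
apply/funext => j; apply/matrixP => a b.
by rewrite !mxE xy// inE /= eqxx.
Qed.

Lemma channel_of_subst x e h i k m :
  channel_of (subst x e h) i k m =
  (1 - h) *: channel_of (subst x e 0) i k m + h *: channel_of (subst x e 1) i k m.
Proof.
apply/matrixP => a b; rewrite !mxE /subst; case: eqP => _.
  by rewrite mulr0 mulr1 add0r.
by rewrite -mulrDl subrK mul1r.
Qed.

Lemma precoder_subst theta x e h : e \in free_entries ->
  precoder theta (subst x e h) = precoder theta x.
Proof.
move=> eF; apply: eq_precoder => e' e'F; rewrite /subst; case: eqP => // ee'.
by rewrite ee' eF in e'F.
Qed.

Lemma received_subst theta x e h k : e \in free_entries ->
  received theta (subst x e h) k =
  (1 - h) *: received theta (subst x e 0) k + h *: received theta (subst x e 1) k.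
Proof.
move=> eF; rewrite /received !(precoder_subst _ _ _ eF).
move: (precoder theta x) => V.
rewrite !scale_row_mx add_row_mx; congr row_mx.
  by rewrite channel_of_subst mulmxDl -!scalemxAl.
apply/matrixP => a j; rewrite [LHS]mxE channel_of_subst mulmxDl -!scalemxAl.
by rewrite !mxE.
Qed.

(** The precoders ignore a free entry, so it acts only through its own receive antenna. This
    confinement to one row keeps the minors of degree at most one in it. *)
Lemma received_subst_row theta x e h h' k a j :
  e \in free_entries -> a != e.2.1 ->
  received theta (subst x e h) k a j = received theta (subst x e h') k a j.
Proof.
move=> eF ae.
have chanE i m (c : 'M[C]_(NU, ds)) q :
    (channel_of (subst x e h) i m k *m c) a q = (channel_of (subst x e h') i m k *m c) a q.
  rewrite !mxE; apply: eq_bigr => b _; rewrite !mxE /subst.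
  by case: eqP => // E; rewrite -E eqxx in ae.
rewrite /received !(precoder_subst _ _ _ eF); move: (precoder theta x) => V.
rewrite -(splitK j); case: (fintype.split j) => j' /=.
  by rewrite !row_mxEl chanE.
by rewrite !row_mxEr mxE [RHS]mxE; exact: chanE.
Qed.

Definition received_minor theta k
    (sel : 'I_(ds + #|other_stream ds l.+1 K|) -> 'I_NB) x : C :=
  \det (rowsub sel (received theta x k)).

Lemma received_minor_affine theta k sel e :
  injective sel -> e \in free_entries -> affine_in (received_minor theta k sel) e.
Proof.
move=> sel_inj eF x h; rewrite /received_minor (received_subst _ _ _ _ eF).
have := fun a j => received_subst_row theta x 0 1 k j eF (a := a).
move: (received theta (subst x e 0) k) (received theta (subst x e 1) k) => A B AB.
exact: det_rowsub_affine AB.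
Qed.

Lemma mxmeasurable_channel_of d' (T' : measurableType d') (x : entry -> T' -> C) i k m :
  (forall e, cmeasurable (x e)) ->
  mxmeasurable (fun t => channel_of (x^~ t) i k m).
Proof.
move=> mx a b; rewrite (_ : (fun t => _) = x ((i, k, m), (a, b)))//.
by apply/funext => t; rewrite mxE.
Qed.

Lemma received_minor_measurable theta k sel :
  measurable_op (received_minor theta k sel).
Proof.
move=> d' T' x mx; apply: cmeasurable_det; apply: mxmeasurable_sub.
have mV i m : mxmeasurable (fun t => precoder theta (x^~ t) i m).
  by apply: mxmeasurable_aligned_precoder => j; exact: mxmeasurable_channel_of.
apply: mxmeasurable_received => [|i n]; apply: mxmeasurableM => //;
  exact: mxmeasurable_channel_of.
Qed.

(** A single minor certifying full rank: it is affine in every entry and equals 1 at the channel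
    with ones on the diagonal. *)
Definition corner_minor (u : 'I_l.+1 * 'I_K.+1 * 'I_K.+1) x : C :=
  \det (rowsub (widen_ord (geq_minl NB NU))
    (colsub (widen_ord (geq_minr NB NU)) (channel_of x u.1.1 u.1.2 u.2))).

Lemma corner_minor_affine u e : affine_in (corner_minor u) e.
Proof.
move=> x h; rewrite /corner_minor channel_of_subst.
rewrite [colsub _ (_ + _)](_ : _ =
  (1 - h) *: colsub (widen_ord (geq_minr NB NU))
    (channel_of (subst x e 0) u.1.1 u.1.2 u.2) +
  h *: colsub (widen_ord (geq_minr NB NU))
    (channel_of (subst x e 1) u.1.1 u.1.2 u.2)); last first.
  by apply/matrixP => a b; rewrite !mxE.
apply: (det_rowsub_affine (a := e.2.1)).
  by move=> a b /(congr1 val) /= /val_inj.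
move=> a b ae; rewrite !mxE /subst; case: eqP => // E.
by rewrite -E eqxx in ae.
Qed.

Lemma corner_minor_measurable u : measurable_op (corner_minor u).
Proof.
move=> d' T' x mx; apply: cmeasurable_det; do 2![apply: mxmeasurable_sub].
exact: mxmeasurable_channel_of.
Qed.

Lemma corner_minor_neq0 u : exists x, corner_minor u x != 0.
Proof.
exists (fun e : entry => (val e.2.1 == val e.2.2)%:R).
rewrite /corner_minor [rowsub _ _](_ : _ = 1%:M) ?det1 ?oner_eq0//.
by apply/matrixP => a b; rewrite !mxE.
Qed.

Lemma corner_minor_rank u x : corner_minor u x != 0 ->
  (minn NB NU <= \rank (channel_of x u.1.1 u.1.2 u.2))%N.
Proof.
rewrite -unitfE -unitmxE => /mxrank_unit {1}<-.
set f := widen_ord _; set g := widen_ord _; set A := channel_of _ _ _ _.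
have -> : rowsub f (colsub g A) = rowsub f 1%:M *m (A *m colsub g 1%:M).
  by rewrite mulmx_colsub mulmx1 mul_rowsub_mx mul1mx.
exact: leq_trans (mxrankM_maxr _ _) (mxrankM_maxl _ _).
Qed.

Lemma received_row_free theta x k sel :
  received_minor theta k sel x != 0 -> row_free (received theta x k)^T.
Proof.
rewrite -unitfE -unitmxE => /mxrank_unit rE.
rewrite /row_free mxrank_tr eqn_leq rank_leq_col /= -{1}rE.
by rewrite -[X in rowsub _ X]mul1mx -mul_rowsub_mx mxrankM_maxr.
Qed.

(* The precoders being left invertible, the free channels can be chosen so that
the received signals are any prescribed completion of the aligned interference. *)
Lemma exists_received_minor theta x k :
  (ds + l.+1 * K * ds <= NB)%N ->
  (forall i m, row_free (precoder theta x i m)^T) ->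
  row_free (channel_of x ord0 ((pi^-1)%g k) k *m precoder theta x ord0 ((pi^-1)%g k))^T ->
  exists sel y, [/\ injective sel,
    forall e, e \notin free_entries -> y e = x e &
    received_minor theta k sel y != 0].
Proof.
move=> dsNB freeV freeA; set m0 := (pi^-1)%g k in freeA.
have [B freeD] := received_mx_complete freeA dsNB.
pose X i m := (pinvmx (precoder theta x i m)^T)^T.
have XV i m : X i m *m precoder theta x i m = 1%:M.
  by apply: trmx_inj; rewrite trmx_mul trmxK mulmxVp ?trmx1.
(* Only channels to BS [k] from the non-aligned cells are changed, to [B *m X]; composed with the
   precoder they yield [B]. *)
pose y (e : entry) : C :=
  if e.1.2 == k then
    if unlift m0 e.1.1.2 is Some n then
      (B e.1.1.1 n *m X e.1.1.1 e.1.1.2) e.2.1 e.2.2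
    else x e
  else x e.
have yx e : e \notin free_entries -> y e = x e.
  rewrite inE negbK /y => /eqP ->; case: eqP => // piE; case: unliftP => // n E.
  by have := neq_lift m0 n; rewrite -E /m0 -piE permK eqxx.
have received_y : received theta y k =
    received_mx (channel_of x ord0 m0 k *m precoder theta x ord0 m0) B.
  rewrite /received (eq_precoder theta yx); congr received_mx.
    congr (_ *m _); apply/matrixP => a b.
    by rewrite !mxE /y /= eqxx unlift_none.
  apply/funext => i; apply/funext => n.
  rewrite (_ : channel_of y i (lift m0 n) k = B i n *m X i (lift m0 n)).
    by rewrite -mulmxA XV mulmx1.
  by apply/matrixP => a b; rewrite mxE /y /= eqxx liftK.
have full : row_full (received theta y k) by rewrite /row_full -mxrank_tr received_y.
exists (fullrankfun full), y; split => //; first exact: fullrankfun_inj.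
by rewrite -unitfE -unitmxE; exact: fullrowsub_unit.
Qed.

(** The second clause covers every [theta] and [sel], since the suitable ones depend on [x], and
    compares [x] with any change of its free entries. *)
Definition generic x : Prop :=
  (forall u, corner_minor u x != 0) /\
  (forall theta k (sel : {ffun _ -> _}), injective sel -> forall y,
     (forall e, e \notin free_entries -> y e = x e) ->
     received_minor theta k sel y != 0 -> received_minor theta k sel x != 0).

Local Open Scope sesquilinear_scope.

Lemma zero_forcing_gia (G : 'I_l.+1 -> 'I_K.+1 -> 'I_K.+1 -> 'M[C]_(NB, NU))
    (V : 'I_l.+1 -> 'I_K.+1 -> 'M[C]_(NU, ds)) :
  assignment pi ->
  (forall i m, G i m (pi m) *m V i m = G ord0 m (pi m) *m V ord0 m) ->
  (forall k i n, exists W : 'M[C]_(ds, NB),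
     [/\ W *m (G ord0 ((pi^-1)%g k) k *m V ord0 ((pi^-1)%g k)) = 0,
         W *m (G i (lift ((pi^-1)%g k) n) k *m V i (lift ((pi^-1)%g k) n)) = 1%:M &
         forall i' n', (i', n') != (i, n) ->
           W *m (G i' (lift ((pi^-1)%g k) n') k *m V i' (lift ((pi^-1)%g k) n')) = 0]) ->
  exists U : 'I_l.+1 -> 'I_K.+1 -> 'M[C]_(NB, ds),
    [/\ gia_aligned G V pi, nulls_inter_user G V U,
        nulls_inter_cell G V U & rank_condition G V U].
Proof.
move=> piN alignV decoder_ex.
have {decoder_ex} [W WP] := 
  fin_all_exists (fun k => fin_all_exists (fun i => fin_all_exists (decoder_ex k i))).
have pi_neq k : (pi^-1)%g k != k.
  by apply: contra (piN k) => /eqP {1}<-; rewrite permKV.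
(* The default 0 is never taken: [pi] has no fixed point, so [k] always differs from the cell
   aligned at BS [k]. *)
pose U i k : 'M[C]_(NB, ds) :=
  if unlift ((pi^-1)%g k) k is Some n then (W k i n)^t* else 0.
have UE k n : k = lift ((pi^-1)%g k) n -> forall i, (U i k)^t* = W k i n.
  by move=> kn i; rewrite /U {2}kn liftK trmxCK.
exists U; split.
- by move=> k i j; rewrite !alignV.
- move=> i j k ji; have [n kn _] := unlift_some (pi_neq k).
  rewrite (UE _ _ kn) -mulmxA; have [_ _] := WP k i n.
  by move=> /(_ j n); rewrite -kn; apply; rewrite xpair_eqE negb_and ji.
- move=> i k j m mk; have [n kn _] := unlift_some (pi_neq k).
  rewrite (UE _ _ kn) -mulmxA; have [W0 _ WB] := WP k i n.
  have [n' mn'|m0] := unliftP ((pi^-1)%g k) m.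
    rewrite mn'; apply: WB; rewrite xpair_eqE negb_and.
    by apply/orP; right; apply: contra mk => /eqP nn'; rewrite mn' nn' -kn.
  (* For the aligned cell, every user's signal equals that of user [ord0], which the decoder
     annihilates. *)
  by move: W0; rewrite m0; have := alignV j ((pi^-1)%g k); rewrite permKV => ->.
- move=> i k; have [n kn _] := unlift_some (pi_neq k).
  rewrite (UE _ _ kn) -mulmxA; have [_ W1 _] := WP k i n.
  by move: W1; rewrite -kn => ->; rewrite mxrank1.
Qed.

Lemma generic_gia x : (ds <= NB)%N -> (l * NB + ds <= l.+1 * NU)%N ->
  (ds + l.+1 * K * ds <= NB)%N -> assignment pi -> generic x ->
  exists (V : 'I_l.+1 -> 'I_K.+1 -> 'M[C]_(NU, ds))
         (U : 'I_l.+1 -> 'I_K.+1 -> 'M[C]_(NB, ds)),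
    [/\ gia_aligned (channel_of x) V pi, nulls_inter_user (channel_of x) V U,
        nulls_inter_cell (channel_of x) V U & rank_condition (channel_of x) V U].
Proof.
move=> dsNB dsNU dsNB' piN [cornerx genx].
have choice_ex m : exists c : precoder_choice,
    (forall i, channel_of x i m (pi m) *m
       aligned_precoder (fun j => channel_of x j m (pi m)) c.1 c.2 i =
     channel_of x ord0 m (pi m) *m
       aligned_precoder (fun j => channel_of x j m (pi m)) c.1 c.2 ord0) /\
    row_free (channel_of x ord0 m (pi m) *m
       aligned_precoder (fun j => channel_of x j m (pi m)) c.1 c.2 ord0)^T.
  have [S [s Ss]] := exists_aligned_precoder (H := fun j => channel_of x j m (pi m))
    (fun i => corner_minor_rank (cornerx (i, m, pi m))) dsNB dsNU.
  by exists (S, s).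
have [theta0 theta0P] := fin_all_exists choice_ex.
pose theta := [ffun m => theta0 m].
have alignV i m : channel_of x i m (pi m) *m precoder theta x i m =
    channel_of x ord0 m (pi m) *m precoder theta x ord0 m.
  by rewrite /precoder ffunE; have [] := theta0P m.
have freeA m : row_free (channel_of x ord0 m (pi m) *m precoder theta x ord0 m)^T.
  by rewrite /precoder ffunE; have [] := theta0P m.
(* All users of a cell share the same received image of rank [ds], so each precoder has rank [ds] as
   well. *)
have freeV i m : row_free (precoder theta x i m)^T.
  have := freeA m; rewrite -(alignV i) trmx_mul -!row_leq_rank => fA.
  exact: leq_trans fA (mxrankM_maxl _ _).
have decoder_ex k i n : exists W : 'M[C]_(ds, NB),
    [/\ W *m (channel_of x ord0 ((pi^-1)%g k) k *m precoder theta x ord0 ((pi^-1)%g k)) = 0,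
        W *m (channel_of x i (lift ((pi^-1)%g k) n) k *m
          precoder theta x i (lift ((pi^-1)%g k) n)) = 1%:M &
        forall i' n', (i', n') != (i, n) ->
          W *m (channel_of x i' (lift ((pi^-1)%g k) n') k *m
            precoder theta x i' (lift ((pi^-1)%g k) n')) = 0].
  have := freeA ((pi^-1)%g k); rewrite permKV => freeAk.
  have [sel [y [sel_inj yx ynz]]] := exists_received_minor dsNB' freeV freeAk.
  have selE : sel = [ffun j => sel j] by apply/funext => j; rewrite ffunE.
  rewrite selE in sel_inj ynz.
  have := received_row_free (genx theta k _ sel_inj y yx ynz).
  by move/zero_forcing => /(_ i n).
by exists (precoder theta x); exact: zero_forcing_gia.
Qed.

End Construction.

Lemma exists_assignment K : exists pi : {perm 'I_K.+2}, assignment pi.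
Proof.
(* The cyclic shift: the last index wraps to 0, which differs from it because there are at least two
   cells. *)
exists (perm (@ordS_inj K.+2)) => k; rewrite permE -val_eqE /=.
have := ltn_ord k; rewrite leq_eqVlt => /orP[/eqP kK|kK].
  by rewrite kK modnn; move: kK; case: (val k).
by rewrite modn_small// neq_ltn ltnS leqnn orbT.
Qed.

(** * Invariance under path loss and power scaling *)

Section Scaling.
Context (R : realType) (K L NB NU ds : nat).
Local Notation C := R[i].
Context (G : 'I_L -> 'I_K -> 'I_K -> 'M[C]_(NB, NU)).
Context (V : 'I_L -> 'I_K -> 'M[C]_(NU, ds)) (U : 'I_L -> 'I_K -> 'M[C]_(NB, ds)).
Context (s : 'I_L -> 'I_K -> 'I_K -> C) (c : 'I_L -> 'I_K -> C).
Hypotheses (s0 : forall i k m, s i k m != 0) (c0 : forall i k, c i k != 0).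
Local Notation sG := (fun i k m => s i k m *: G i k m).
Local Notation cV := (fun i k => c i k *: V i k).

Lemma gia_aligned_scale pi : gia_aligned G V pi -> gia_aligned sG cV pi.
Proof.
move=> aligned k i j; rewrite /= -!scalemxAl -!scalemxAr !scalerA !linearZ /=.
apply: eqmx_trans (eqmx_trans (aligned k i j) (eqmx_sym _));
  by apply: eqmx_scale; rewrite mulf_neq0.
Qed.

Lemma nulls_inter_user_scale : nulls_inter_user G V U -> nulls_inter_user sG cV U.
Proof.
by move=> nulls i j k ji; rewrite /= -scalemxAr -scalemxAr -scalemxAl nulls// !scaler0.
Qed.

Lemma nulls_inter_cell_scale : nulls_inter_cell G V U -> nulls_inter_cell sG cV U.
Proof.
by move=> nulls i k m j jk; rewrite /= -scalemxAr -scalemxAr -scalemxAl nulls// !scaler0.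
Qed.

Lemma rank_condition_scale : rank_condition G V U -> rank_condition sG cV U.
Proof.
move=> rk i k; rewrite /= -scalemxAr -scalemxAr -scalemxAl scalerA mxrank_scale_nz//.
by rewrite mulf_neq0.
Qed.

End Scaling.

Section PowerScaling.
Context (R : realType).
Local Open Scope sesquilinear_scope.

Lemma exists_power_scale m n (V : 'M[R[i]]_(m, n)) (p : R) : 0 < p ->
  exists2 c : R[i], c != 0 & \tr ((c *: V)^t* *m (c *: V)) <= p%:C.
Proof.
move=> p0; set q := \tr (V^t* *m V).
have q0 : 0 <= q.
  rewrite /q /mxtrace sumr_ge0// => j _; rewrite mxE sumr_ge0// => a _.
  by rewrite !mxE mulrC mul_conjC_ge0.
have qE : q = (complex.Re q)%:C by case: q q0 => a b /= /andP[/eqP -> _].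
have rq0 : 0 <= complex.Re q by move: q0; rewrite qE lecR.
(* The summand 1 keeps the denominator positive even when [V] is zero, and gives
   [r ^+ 2 * q <= p]. *)
pose r := Num.sqrt (p / (1 + complex.Re q)).
have q1 : 0 < 1 + complex.Re q by rewrite ltr_pwDl.
have r0 : 0 < r by rewrite sqrtr_gt0 divr_gt0.
exists r%:C; first by rewrite (inj_eq (@complexI R)) gt_eqF.
have -> : \tr ((r%:C *: V)^t* *m (r%:C *: V)) = (r ^+ 2 * complex.Re q)%:C.
  have -> : (r%:C *: V)^t* = r%:C *: V^t*.
    apply/matrixP => a b; rewrite !mxE rmorphM /=; congr (_ * _).
    by rewrite conj_Creal// ger0_real// lecR ltW.
  by rewrite -scalemxAl -scalemxAr scalerA linearZ /= -/q {1}qE expr2 !rmorphM.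
have d0 : 0 <= p / (1 + complex.Re q) by rewrite ltW// divr_gt0.
rewrite lecR (sqr_sqrtr d0) mulrAC ler_pdivrMr// ler_pM2l//.
by rewrite lerDr.
Qed.

End PowerScaling.

(** * Almost sure genericity and conclusion *)

Section RayleighGeneric.
Context (R : realType) (d : measure_display) (T : measurableType d).
Context (P : probability T R) (K l NB NU ds : nat) (pi : {perm 'I_K.+1}).
Context (Hbar : 'I_l.+1 -> 'I_K.+1 -> 'I_K.+1 -> T -> 'M[R[i]]_(NB, NU)).
Hypothesis Hbar_rayleigh : rayleigh_fading P Hbar.

Lemma ae_corner_minor u : {ae P, forall t, corner_minor u (entries Hbar t) != 0}.
Proof.
have := rayleigh_ae_nonvanishing Hbar_rayleigh (f := corner_minor u) (F := [set: _]%SET)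
  (corner_minor_measurable u) (fun e _ => corner_minor_affine u e).
apply: filterS => t; have [x xnz] := corner_minor_neq0 R NB NU u.
by move=> /(_ x); apply=> // e; rewrite inE.
Qed.

Lemma ae_received_minor (theta : {ffun 'I_K.+1 -> precoder_choice l NB NU ds}) k
    (sel : {ffun 'I_(ds + #|other_stream ds l.+1 K|) -> 'I_NB}) : injective sel ->
  {ae P, forall t, forall y,
    (forall e, e \notin free_entries l NB NU pi -> y e = entries Hbar t e) ->
    received_minor pi theta k sel y != 0 ->
    received_minor pi theta k sel (entries Hbar t) != 0}.
Proof.
move=> sel_inj.
have := @received_minor_measurable R K l NB NU ds pi theta k sel.
have := fun e => @received_minor_affine R K l NB NU ds pi theta k sel e sel_inj.
move: (received_minor pi theta k sel) => f faff fmeas.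
exact (rayleigh_ae_nonvanishing Hbar_rayleigh fmeas faff).
Qed.

(** Precoder choices and row selections form finite types, so finitely many almost sure statements
    are intersected. *)
Lemma rayleigh_generic : {ae P, forall t, generic ds pi (entries Hbar t)}.
Proof.
have corner_ae : {ae P, forall t, forall u, corner_minor u (entries Hbar t) != 0}.
  by apply: filter_forall => u; exact: ae_corner_minor.
have received_ae : {ae P, forall t,
    forall (theta : {ffun 'I_K.+1 -> precoder_choice l NB NU ds}) k
      (sel : {ffun 'I_(ds + #|other_stream ds l.+1 K|) -> 'I_NB}), injective sel ->
    forall y, (forall e, e \notin free_entries l NB NU pi -> y e = entries Hbar t e) ->
    received_minor pi theta k sel y != 0 ->
    received_minor pi theta k sel (entries Hbar t) != 0}.
  apply: filter_forall => theta; apply: filter_forall => k.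
  apply: filter_forall => sel.
  have [/injectiveP sel_inj|sel_ninj] := boolP (injectiveb sel).
    have := ae_received_minor theta k sel_inj.
    by apply: filterS => t nz _; exact nz.
  apply: aeW => t sel_inj; case/negP: sel_ninj.
  exact/injectiveP.
by apply: filterS2 corner_ae received_ae => t; split.
Qed.

End RayleighGeneric.

Theorem proposition1
  (R : realType) (d : measure_display) (T : measurableType d)
  (P : probability T R)
  (K L NB NU ds : nat)
  (K_ge2 : (2 <= K)%N) (L_ge2 : (2 <= L)%N)
  (NB_ge1 : (1 <= NB)%N) (NU_ge1 : (1 <= NU)%N) (ds_ge1 : (1 <= ds)%N)
  (p : 'I_L -> 'I_K -> R) (p_gt0 : forall i k, 0 < p i k)
  (eta : 'I_L -> 'I_K -> 'I_K -> R) (eta_gt0 : forall i k l, 0 < eta i k l)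
  (Hbar : 'I_L -> 'I_K -> 'I_K -> T -> 'M[R[i]]_(NB, NU))
  (Hbar_rayleigh : rayleigh_fading P Hbar)
  (NU_large : (NU%:R : R) >= (L%:R - 1) / L%:R * NB%:R + 1 / L%:R * ds%:R)
  (NB_large : (NB >= ((K - 1) * L + 1) * ds)%N) :
  {ae P, forall t, let H := channel eta Hbar t in
     exists (pi : {perm 'I_K}) (V : 'I_L -> 'I_K -> 'M[R[i]]_(NU, ds))
            (U : 'I_L -> 'I_K -> 'M[R[i]]_(NB, ds)),
       [/\ assignment pi,
           within_power V p,
           gia_aligned H V pi
         & [/\ nulls_inter_user H V U,
               nulls_inter_cell H V U
             & rank_condition H V U]]}.
Proof.
case: K K_ge2 p p_gt0 eta eta_gt0 Hbar Hbar_rayleigh NB_large => [//|[//|K']] _.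
case: L L_ge2 NU_large => [//|l] _ NU_large.
move=> p p_gt0 eta eta_gt0 Hbar Hbar_rayleigh NB_large.
(* The real inequality multiplied by the number of users [l.+1]. *)
have dsNU : (l * NB + ds <= l.+1 * NU)%N.
  have L0 : 0 < l.+1%:R :> R by rewrite ltr0n.
  move: NU_large; rewrite -(ler_pM2l L0) mulrDr !mulrA.
  rewrite [_ * (_ - 1)]mulrC mulfK ?gt_eqF// mulr1 divff ?gt_eqF// mul1r.
  by rewrite -[X in _ - X](mulr1n 1) -natrB// subn1 -!natrM -natrD ler_nat.
have dsNB' : (ds + l.+1 * K'.+1 * ds <= NB)%N by lia.
have dsNB : (ds <= NB)%N by apply: leq_trans dsNB'; rewrite leq_addr.
have [pi piN] := exists_assignment K'.
have generic_ae := rayleigh_generic ds pi Hbar_rayleigh.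
apply: filterS generic_ae => t gent.
have [V [U [al nu nc rk]]] := generic_gia dsNB dsNU dsNB' piN gent.
have GE : channel_of (entries Hbar t) = fun i k m => Hbar i k m t.
  apply/funext => i; apply/funext => k; apply/funext => m.
  by apply/matrixP => a b; rewrite mxE.
rewrite GE in al nu nc rk.
have c_ex i k := exists_power_scale (V i k) (p_gt0 i k).
pose c i k := projT1 (cid2 (c_ex i k)).
have c0 i k : c i k != 0 by rewrite /c; case: cid2.
have cV : within_power (fun i k => c i k *: V i k) p.
  by move=> i k; rewrite /c; case: cid2.
(* The solution found for the normalized channels survives these nonzero path-loss factors and the
   power scaling of the precoders. *)
have s0 i k m : (Num.sqrt (eta i k m))%:C != 0 :> R[i].
  by rewrite (inj_eq (@complexI R)) gt_eqF// sqrtr_gt0.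
exists pi, (fun i k => c i k *: V i k), U; split.
- exact: piN.
- exact: cV.
- exact: gia_aligned_scale al.
split.
- exact: nulls_inter_user_scale nu.
- exact: nulls_inter_cell_scale nc.
- exact: rank_condition_scale rk.
Qed.
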